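(* Let $\mathcal{SV}=\mathcal{SV}[\Gamma,s]$ be the not-finitely graded generalized super-Virasoro algebra. The second cohomology group of $\mathcal{SV}$ is trivial, i.e. $$C^2(\mathcal{SV},\mathbb C)=B^2(\mathcal{SV},\mathbb C).$$
   Context: All vector spaces are over $\mathbb C$; $\mathbb Z_+$ is the set of nonnegative integers. Let $\Gamma$ be an additive subgroup of $\mathbb C$ with $\mathbb Z\subseteq\Gamma$, and let $s\in\mathbb C$ with $2s\in\Gamma$. $\mathcal{SV}=\mathcal{SV}[\Gamma,s]$ is the Lie superalgebra with basis $\{L_{\alpha,i},G_{\mu,j}\mid \alpha\in\Gamma,\ \mu\in s+\Gamma,\ i,j\in\mathbb Z_+\}$ and brackets $$[L_{\alpha,i},L_{\beta,j}]=(\beta-\alpha)L_{\alpha+\beta,i+j}+(j-i)L_{\alpha+\beta,i+j-1},$$ $$[L_{\alpha,i},G_{\mu,j}]=(\mu-\tfrac{\alpha}{2})G_{\alpha+\mu,i+j}+(j-\tfrac{i}{2})G_{\alpha+\mu,i+j-1},$$ $$[G_{\mu,i},G_{\nu,j}]=2L_{\mu+\nu,i+j},$$ for $\alpha,\beta\in\Gamma$, $\mu,\nu\in s+\Gamma$, $i,j\in\mathbb Z_+$. Its even part is $\mathrm{span}\{L_{\alpha,i}\}$ and its odd part is $\mathrm{span}\{G_{\mu,i}\}$. Undefined symbols (e.g. those with a negative second index) are treated as zero. For a Lie superalgebra $L$, with $|x|$ denoting the $\mathbb Z_2$-degree of a homogeneous element $x$: a 2-cocycle on $L$ is a bilinear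 form $\psi:L\times L\to\mathbb C$ such that $\psi(x,y)=-(-1)^{|x||y|}\psi(y,x)$ and $\psi(x,[y,z])=\psi([x,y],z)+(-1)^{|x||y|}\psi(y,[x,z])$ for all homogeneous $x,y\in L$ and all $z\in L$. For a linear map $f:L\to\mathbb C$, the 2-cocycle $\psi_f(x,y)=f([x,y])$ is called a 2-coboundary. $C^2(L,\mathbb C)$ and $B^2(L,\mathbb C)$ are the spaces of all 2-cocycles and of all 2-coboundaries; the second cohomology group is $H^2(L,\mathbb C)=C^2(L,\mathbb C)/B^2(L,\mathbb C)$. *)

(* Defs.v *)
From HB Require Import structures.
From mathcomp Require Import all_boot all_order all_algebra.
From mathcomp Require Import finmap monalg complex ring.
From mathcomp Require Import classical_sets reals.

Set Implicit Arguments.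
Unset Strict Implicit.
Unset Printing Implicit Defensive.

Import Order.TTheory GRing.Theory Num.Theory.
Local Open Scope classical_set_scope.
Local Open Scope ring_scope.

(* [lsa_part false] is the even part and [lsa_part true] the odd part; an
   element is homogeneous when it lies in one of them. *)
Record lieSuperalgebra (K : fieldType) := LieSuperalgebra {
  lsa_sort :> lmodType K;
  lsa_part : bool -> {pred lsa_sort};
  lsa_br : {bilinear lsa_sort -> lsa_sort -> lsa_sort};
  lsa_part_submod : forall a, submod_closed (lsa_part a);
  lsa_part_direct : forall x, x \in lsa_part false -> x \in lsa_part true ->
    x = 0;
  lsa_part_sum : forall x, exists2 x0, x0 \in lsa_part false &
    exists2 x1, x1 \in lsa_part true & x = x0 + x1;
  lsa_br_part : forall a b x y, x \in lsa_part a -> y \in lsa_part b ->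
    lsa_br x y \in lsa_part (a (+) b);
  lsa_br_skew : forall a b x y, x \in lsa_part a -> y \in lsa_part b ->
    lsa_br x y = - ((-1) ^+ (a && b) *: lsa_br y x);
  lsa_br_jacobi : forall a b x y z, x \in lsa_part a -> y \in lsa_part b ->
    lsa_br x (lsa_br y z) =
      lsa_br (lsa_br x y) z + (-1) ^+ (a && b) *: lsa_br y (lsa_br x z)
}.

Section Cohomology.
Variables (K : fieldType) (L : lieSuperalgebra K).

Definition cocycles2 : set (L -> L -> K) := [set psi |
  [/\ bilinear_for *%R *%R psi,
      forall a b x y, x \in @lsa_part K L a -> y \in @lsa_part K L b ->
        psi x y = - ((-1) ^+ (a && b) * psi y x)
    & forall a b x y z, x \in @lsa_part K L a -> y \in @lsa_part K L b ->
        psi x (lsa_br L y z) =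
          psi (lsa_br L x y) z + (-1) ^+ (a && b) * psi y (lsa_br L x z)]].

Definition coboundaries2 : set (L -> L -> K) := [set psi |
  exists f : {scalar L}, psi = fun x y => f (lsa_br L x y)].

End Cohomology.

Arguments cocycles2 {K} L.
Arguments coboundaries2 {K} L.

Section FreeModule.
Variables (K : fieldType) (I : choiceType) (V : lmodType K).
Implicit Types (f : I -> V) (x y : {malg K[I]}).

(* the linear extension of a map given on the basis *)
Definition malg_lift f x : V := \sum_(k <- msupp x) x@_k *: f k.

Lemma malg_liftw f x (d : {fset I}) : (msupp x `<=` d)%fset ->
  malg_lift f x = \sum_(k <- d) x@_k *: f k.
Proof.
move=> le_d; rewrite /malg_lift (big_fset_incl _ le_d) //= => k _ /mcoeff_outdom ->.
by rewrite scale0r.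
Qed.

Lemma malg_lift_linear f : linear (malg_lift f).
Proof.
move=> c x y; pose d := (msupp (c *: x + y) `|` (msupp x `|` msupp y))%fset.
rewrite !(@malg_liftw f _ d) ?fsubsetUl //.
- rewrite scaler_sumr -big_split; apply: eq_bigr => k _ /=.
  by rewrite mcoeffD mcoeffZ scalerDl scalerA.
- by rewrite /d fsetUA fsubsetUr.
- by rewrite /d fsetUCA fsubsetUl.
Qed.

HB.instance Definition _ f :=
  GRing.isLinear.Build K {malg K[I]} V _ (malg_lift f) (malg_lift_linear f).

Lemma malg_lift_fun c f g h x : (forall k, h k = c *: f k + g k) ->
  malg_lift h x = c *: malg_lift f x + malg_lift g x.
Proof.
move=> hE; rewrite /malg_lift scaler_sumr -big_split; apply: eq_bigr => k _ /=.
by rewrite hE scalerDr !scalerA mulrC.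
Qed.

Lemma malg_liftU f k : malg_lift f << k >> = f k.
Proof.
rewrite (@malg_liftw f _ [fset k]%fset) ?msuppU_le //.
by rewrite big_seq_fset1 mcoeffUU scale1r.
Qed.

End FreeModule.

Lemma malg_ind (K : fieldType) (I : choiceType) (P : {malg K[I]} -> Prop) x :
  P 0 -> (forall c u v, P u -> P v -> P (c *: u + v)) ->
  (forall k, k \in msupp x -> P << k >>) -> P x.
Proof.
move=> P0 PD PU; rewrite [x]monalgE big_seq.
elim/big_ind: _ => // [u v Pu Pv|k kx]; first by rewrite -[u]scale1r; apply: PD.
rewrite -[X in P X]addr0; suff -> : << x@_k *g k >> = x@_k *: << k >> :> {malg K[I]}.
  by apply: PD => //; apply: PU.
by apply/malgP => l; rewrite mcoeffZ !mcoeffU mulrnAr mulr1.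
Qed.

Section SuperVirasoro.
Variables (K : numFieldType) (Gamma : zmodClosed K) (s : K).
Hypothesis s2 : 2 * s \in Gamma.

Definition even_index := {a : K | a \in Gamma}.
Definition odd_index := {m : K | m - s \in Gamma}.
HB.instance Definition _ := SubChoice.on even_index.
HB.instance Definition _ := SubChoice.on odd_index.

Lemma addLL_subproof (a b : even_index) : val a + val b \in Gamma.
Proof. exact: rpredD (valP a) (valP b). Qed.
Lemma addLG_subproof (a : even_index) (m : odd_index) :
  val a + val m - s \in Gamma.
Proof. by rewrite -addrA; apply: rpredD (valP a) (valP m). Qed.
Lemma addGG_subproof (m n : odd_index) : val m + val n \in Gamma.
Proof.
have -> : val m + val n = (val m - s) + (val n - s) + 2 * s by ring.
exact: rpredD (rpredD (valP m) (valP n)) s2.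
Qed.

Definition addLL a b : even_index := exist _ (val a + val b) (addLL_subproof a b).
Definition addLG a m : odd_index := exist _ (val a + val m) (addLG_subproof a m).
Definition addGG m n : even_index := exist _ (val m + val n) (addGG_subproof m n).

(* [inl (a, i)] indexes L_{a,i} and [inr (m, j)] indexes G_{m,j} *)
Definition sv_index := (even_index * nat + odd_index * nat)%type.
HB.instance Definition _ := Choice.on sv_index.

Definition sv_space := {malg K[sv_index]}.
HB.instance Definition _ := GRing.Lmodule.on sv_space.

Definition svL (a : even_index) (i : nat) : sv_space := << inl (a, i) >>.
Definition svG (m : odd_index) (j : nat) : sv_space := << inr (m, j) >>.

(* the vectors of second index n - 1, read as 0 when n = 0 *)
Definition svLpred a n : sv_space := if n is n'.+1 then svL a n' else 0.
Definition svGpred m n : sv_space := if n is n'.+1 then svG m n' else 0.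

Definition svLL (a : even_index) i (b : even_index) j : sv_space :=
  (val b - val a) *: svL (addLL a b) (i + j)%N
  + (j%:R - i%:R) *: svLpred (addLL a b) (i + j)%N.
Definition svLG (a : even_index) i (m : odd_index) j : sv_space :=
  (val m - val a / 2) *: svG (addLG a m) (i + j)%N
  + (j%:R - i%:R / 2) *: svGpred (addLG a m) (i + j)%N.
Definition svGG (m : odd_index) i (n : odd_index) j : sv_space :=
  2 *: svL (addGG m n) (i + j)%N.

(* [G, L] is determined by [L, G] through super skew-symmetry *)
Definition sv_basis_br (k l : sv_index) : sv_space :=
  match k, l with
  | inl (a, i), inl (b, j) => svLL a i b j
  | inl (a, i), inr (m, j) => svLG a i m j
  | inr (m, j), inl (a, i) => - svLG a i m j
  | inr (m, i), inr (n, j) => svGG m i n j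
  end.

Definition sv_br (x y : sv_space) : sv_space :=
  malg_lift (fun k => malg_lift (sv_basis_br k) y) x.

Lemma sv_br_bilinear : bilinear_for *:%R *:%R sv_br.
Proof.
split=> [y|x] c u v; first exact: linearP.
by apply: malg_lift_fun => k; apply: linearP.
Qed.
HB.instance Definition _ :=
  bilinear_isBilinear.Build K sv_space sv_space sv_space _ _ sv_br
    sv_br_bilinear.

Lemma sv_brPl y c u v : sv_br (c *: u + v) y = c *: sv_br u y + sv_br v y.
Proof. by case: sv_br_bilinear => H _; exact: H. Qed.

Lemma sv_brPr x c u v : sv_br x (c *: u + v) = c *: sv_br x u + sv_br x v.
Proof. by case: sv_br_bilinear => _ H; exact: H. Qed.

Lemma sv_br0l y : sv_br 0 y = 0.
Proof. exact: linear0l. Qed.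

Lemma sv_br0r x : sv_br x 0 = 0.
Proof. by have := sv_brPr x (-1) 0 0; rewrite scaler0 addr0 scaleN1r addNr. Qed.

Lemma sv_brU (k l : sv_index) : sv_br << k >> << l >> = sv_basis_br k l.
Proof. by rewrite /sv_br !malg_liftU. Qed.

Definition sv_parity (k : sv_index) : bool := if k is inr _ then true else false.

Definition sv_part (p : bool) : {pred sv_space} :=
  [pred x : sv_space | all (fun k => sv_parity k == p) (msupp x)].

Lemma sv_partP p x :
  reflect (forall k, sv_parity k != p -> x@_k = 0) (x \in sv_part p).
Proof.
apply: (iffP allP) => /= [xp k kp|xp k].
  by apply/mcoeff_outdom; apply: contra kp => /xp.
by apply: contraTT => /xp /eqP; rewrite mcoeff_eq0.
Qed.

Lemma sv_part_submod p : submod_closed (sv_part p).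
Proof.
split=> [|c x y /sv_partP xp /sv_partP yp].
  by apply/sv_partP => k _; rewrite mcoeff0.
apply/sv_partP => k kp.
by rewrite mcoeffD mcoeffZ xp // yp // mulr0 addr0.
Qed.

Lemma sv_partU k : << k >> \in sv_part (sv_parity k).
Proof.
apply/sv_partP => l; rewrite mcoeffU; have [->|//] := eqVneq k l.
by rewrite eqxx.
Qed.

Lemma sv_part_ind p (P : sv_space -> Prop) x : x \in sv_part p ->
  P 0 -> (forall c u v, P u -> P v -> P (c *: u + v)) ->
  (forall k, sv_parity k = p -> P << k >>) -> P x.
Proof.
by move=> /allP /= xp P0 PD PU; apply: malg_ind => // k kx; apply/PU/eqP/xp.
Qed.

Lemma sv_part_direct x : x \in sv_part false -> x \in sv_part true -> x = 0.
Proof.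
move=> /sv_partP x0 /sv_partP x1; apply/malgP => k; rewrite mcoeff0.
by case pk: (sv_parity k); [apply: x0|apply: x1]; rewrite pk.
Qed.

Lemma sv_part_sum x : exists2 x0, x0 \in sv_part false &
  exists2 x1, x1 \in sv_part true & x = x0 + x1.
Proof.
have part0 p : 0 \in sv_part p by case: (sv_part_submod p).
pattern x; apply: malg_ind => [|c u v [u0 u0p [u1 u1p ->]] [v0 v0p [v1 v1p ->]]|k _].
- by exists 0 => //; exists 0; rewrite ?addr0.
- exists (c *: u0 + v0); first by case: (sv_part_submod false) => _; apply.
  exists (c *: u1 + v1); first by case: (sv_part_submod true) => _; apply.
  by rewrite scalerDr addrACA.
have := sv_partU k; case: (sv_parity k) => kp.
  by exists 0 => //; exists << k >>; rewrite ?add0r.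
by exists << k >> => //; exists 0; rewrite ?addr0.
Qed.

Lemma sv_basis_br_part k l :
  sv_basis_br k l \in sv_part (sv_parity k (+) sv_parity l).
Proof.
have comb p c d u v : u \in sv_part p -> v \in sv_part p ->
    c *: u + d *: v \in sv_part p.
  move=> up vp; have [p0 pD] := sv_part_submod p.
  by apply: (pD) => //; rewrite -[_ *: _]addr0; apply: pD.
have Lp a n : svLpred a n \in sv_part false.
  by case: n => [|n]; [case: (sv_part_submod false)|apply: sv_partU (inl _)].
have Gp m n : svGpred m n \in sv_part true.
  by case: n => [|n]; [case: (sv_part_submod true)|apply: sv_partU (inr _)].
have Ls a n : svL a n \in sv_part false by apply: sv_partU (inl _).
have Gs m n : svG m n \in sv_part true by apply: sv_partU (inr _).
case: k l => [[a i]|[m i]] [[b j]|[n j]] /=; rewrite /svLL /svLG /svGG.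
- exact: comb.
- exact: comb.
- by rewrite opprD -!scaleNr; apply: comb.
- rewrite -[_ *: _]addr0 -(scale0r 0); apply: comb => //.
  by case: (sv_part_submod false).
Qed.

Lemma sv_br_part p q x y : x \in sv_part p -> y \in sv_part q ->
  sv_br x y \in sv_part (p (+) q).
Proof.
move=> xp yq; have submod p' := sv_part_submod p'.
pattern x; apply: (sv_part_ind xp) => [|c u v up vp|k <-].
- by rewrite sv_br0l; case: (submod (p (+) q)).
- by rewrite sv_brPl; case: (submod (p (+) q)) => _; apply.
pattern y; apply: (sv_part_ind yq) => [|c u v up vp|l <-].
- by rewrite sv_br0r; case: (submod (sv_parity k (+) q)).
- by rewrite sv_brPr; case: (submod (sv_parity k (+) q)) => _; apply.
by rewrite sv_brU; apply: sv_basis_br_part.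
Qed.

Lemma addLLC a b : addLL a b = addLL b a.
Proof. by apply/val_inj; rewrite /= addrC. Qed.

Lemma addGGC m n : addGG m n = addGG n m.
Proof. by apply/val_inj; rewrite /= addrC. Qed.

Lemma sv_basis_br_skew k l : sv_basis_br k l =
  - ((-1) ^+ (sv_parity k && sv_parity l) *: sv_basis_br l k).
Proof.
case: k l => [[a i]|[m i]] [[b j]|[n j]]; rewrite /sv_parity /sv_basis_br.
- by rewrite expr0 scale1r /svLL addLLC addnC opprD -!scaleNr !opprB.
- by rewrite expr0 scale1r opprK.
- by rewrite expr0 scale1r.
- by rewrite expr1 scaleN1r opprK /svGG addGGC addnC.
Qed.

Lemma sv_br_skew p q x y : x \in sv_part p -> y \in sv_part q ->
  sv_br x y = - ((-1) ^+ (p && q) *: sv_br y x).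
Proof.
move=> xp yq.
pattern x; apply: (sv_part_ind xp) => [|c u v up vp|k <-].
- by rewrite sv_br0l sv_br0r scaler0 oppr0.
- rewrite sv_brPl sv_brPr up vp /= scalerDr opprD !scalerA.
  by rewrite scalerN scalerA (mulrC c).
pattern y; apply: (sv_part_ind yq) => [|c u v up vp|l <-].
- by rewrite sv_br0l sv_br0r scaler0 oppr0.
- rewrite sv_brPl sv_brPr up vp /= scalerDr opprD !scalerA.
  by rewrite scalerN scalerA (mulrC c).
by rewrite !sv_brU sv_basis_br_skew.
Qed.

Section JacobiOnGenerators.
(* stated over an abstract module, where unification does not unfold the
   operations of the free module *)
Variables (V : lmodType K) (br : {bilinear V -> V -> V}).
Variables (eL : even_index -> nat -> V) (eG : odd_index -> nat -> V).
Let Lp a n : V := if n is n'.+1 then eL a n' else 0.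
Let Gp m n : V := if n is n'.+1 then eG m n' else 0.
Let Lpp a n : V := if n is n'.+2 then eL a n' else 0.
Let Gpp m n : V := if n is n'.+2 then eG m n' else 0.
Let LL a i b j := (val b - val a) *: eL (addLL a b) (i + j)
  + (j%:R - i%:R) *: Lp (addLL a b) (i + j).
Let LG a i m j := (val m - val a / 2) *: eG (addLG a m) (i + j)
  + (j%:R - i%:R / 2) *: Gp (addLG a m) (i + j).
Hypothesis brLL : forall a i b j, br (eL a i) (eL b j) = LL a i b j.
Hypothesis brLG : forall a i m j, br (eL a i) (eG m j) = LG a i m j.
Hypothesis brGL : forall m j a i, br (eG m j) (eL a i) = - LG a i m j.
Hypothesis brGG : forall m i n j,
  br (eG m i) (eG n j) = 2 *: eL (addGG m n) (i + j).

Let brDl y c d u v : br (c *: u + d *: v) y = c *: br u y + d *: br v y.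
Proof. by rewrite linearPl linearZl_LR. Qed.
Let brDr x c d u v : br x (c *: u + d *: v) = c *: br x u + d *: br x v.
Proof. by rewrite linearPr linearZr_LR. Qed.
Let brZl y c u : br (c *: u) y = c *: br u y.
Proof. by rewrite linearZl_LR. Qed.
Let brZr x c u : br x (c *: u) = c *: br x u.
Proof. by rewrite linearZr_LR. Qed.
Let brNl y u : br (- u) y = - br u y.
Proof. by rewrite linearNl. Qed.
Let brNr x u : br x (- u) = - br x u.
Proof. by rewrite linearNr. Qed.

Let brLLp a i b n d : (n = 0%N -> d = 0) ->
  d *: br (eL a i) (Lp b n) =
  (d * (val b - val a)) *: Lp (addLL a b) (i + n)
  + (d * (n%:R - 1 - i%:R)) *: Lpp (addLL a b) (i + n).
Proof.
case: n => [->|n _] //;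
  first by rewrite ?(linear0l, linear0r) !mul0r !scale0r addr0.
have e : n.+1%:R - 1 = n%:R :> K by rewrite -natr1 addrK.
by rewrite addnS brLL scalerDr !scalerA e.
Qed.

Let brLpL a n b j d : (n = 0%N -> d = 0) ->
  d *: br (Lp a n) (eL b j) =
  (d * (val b - val a)) *: Lp (addLL a b) (n + j)
  + (d * (j%:R - (n%:R - 1))) *: Lpp (addLL a b) (n + j).
Proof.
case: n => [->|n _] //;
  first by rewrite ?(linear0l, linear0r) !mul0r !scale0r addr0.
have e : n.+1%:R - 1 = n%:R :> K by rewrite -natr1 addrK.
by rewrite addSn brLL scalerDr !scalerA e.
Qed.

Let brLGp a i m n d : (n = 0%N -> d = 0) ->
  d *: br (eL a i) (Gp m n) =
  (d * (val m - val a / 2)) *: Gp (addLG a m) (i + n)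
  + (d * (n%:R - 1 - i%:R / 2)) *: Gpp (addLG a m) (i + n).
Proof.
case: n => [->|n _] //;
  first by rewrite ?(linear0l, linear0r) !mul0r !scale0r addr0.
have e : n.+1%:R - 1 = n%:R :> K by rewrite -natr1 addrK.
by rewrite addnS brLG scalerDr !scalerA e.
Qed.

Let brLpG a n m j d : (n = 0%N -> d = 0) ->
  d *: br (Lp a n) (eG m j) =
  (d * (val m - val a / 2)) *: Gp (addLG a m) (n + j)
  + (d * (j%:R - (n%:R - 1) / 2)) *: Gpp (addLG a m) (n + j).
Proof.
case: n => [->|n _] //;
  first by rewrite ?(linear0l, linear0r) !mul0r !scale0r addr0.
have e : n.+1%:R - 1 = n%:R :> K by rewrite -natr1 addrK.
by rewrite addSn brLG scalerDr !scalerA e.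
Qed.

Let brGpL m n a i d : (n = 0%N -> d = 0) ->
  d *: br (Gp m n) (eL a i) =
  - ((d * (val m - val a / 2)) *: Gp (addLG a m) (i + n)
  + (d * (n%:R - 1 - i%:R / 2)) *: Gpp (addLG a m) (i + n)).
Proof.
case: n => [->|n _] //;
  first by rewrite !mul0r !scale0r addr0 oppr0.
have e : n.+1%:R - 1 = n%:R :> K by rewrite -natr1 addrK.
by rewrite addnS brGL scalerN scalerDr !scalerA e.
Qed.

Let brGLp m j a n d : (n = 0%N -> d = 0) ->
  d *: br (eG m j) (Lp a n) =
  - ((d * (val m - val a / 2)) *: Gp (addLG a m) (n + j)
  + (d * (j%:R - (n%:R - 1) / 2)) *: Gpp (addLG a m) (n + j)).
Proof.
case: n => [->|n _] //;
  first by rewrite !mul0r !scale0r addr0 oppr0.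
have e : n.+1%:R - 1 = n%:R :> K by rewrite -natr1 addrK.
by rewrite addSn brGL scalerN scalerDr !scalerA e.
Qed.

Let brGGp m i n j d : (j = 0%N -> d = 0) ->
  d *: br (eG m i) (Gp n j) = (d * 2) *: Lp (addGG m n) (i + j).
Proof.
case: j => [->|j _] //;
  first by rewrite !mul0r !scale0r.
by rewrite addnS brGG scalerA.
Qed.

Let brGpG m i n j d : (i = 0%N -> d = 0) ->
  d *: br (Gp m i) (eG n j) = (d * 2) *: Lp (addGG m n) (i + j).
Proof.
case: i => [->|i _] //;
  first by rewrite !mul0r !scale0r.
by rewrite addSn brGG scalerA.
Qed.

Let condL i j : (i + j = 0)%N -> j%:R - i%:R = 0 :> K.
Proof. by move/eqP; rewrite addn_eq0 => /andP[/eqP-> /eqP->]; rewrite subrr. Qed.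
Let condG i j : (i + j = 0)%N -> j%:R - i%:R / 2 = 0 :> K.
Proof.
by move/eqP; rewrite addn_eq0 => /andP[/eqP-> /eqP->]; rewrite mul0r subrr.
Qed.

Ltac jac_expand :=
  rewrite ?(brLL, brLG, brGL, brGG) /LL /LG
    ?(brNl, brNr, brDl, brDr, brZl, brZr);
  rewrite ?(brLLp, brLpL, brLGp, brLpG, brGpL, brGLp, brGGp, brGpG);
  try exact: condL; try exact: condG;
  rewrite ?(brLL, brLG, brGL, brGG) /LL /LG.

Let comb (P Q R : V) x y z : V := x *: P + y *: Q + z *: R.
Let combD P Q R x y z x' y' z' : comb P Q R x y z + comb P Q R x' y' z' =
  comb P Q R (x + x') (y + y') (z + z').
Proof.
rewrite /comb !scalerDl [LHS]addrACA; congr (_ + _).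
by rewrite [LHS]addrACA.
Qed.
Let combZ P Q R c x y z :
  c *: comb P Q R x y z = comb P Q R (c * x) (c * y) (c * z).
Proof. by rewrite /comb !scalerDr !scalerA. Qed.
Let combN P Q R x y z : - comb P Q R x y z = comb P Q R (- x) (- y) (- z).
Proof. by rewrite /comb !opprD !scaleNr. Qed.
Let combE (P Q R : V) : [/\ P = comb P Q R 1 0 0, Q = comb P Q R 0 1 0
  & R = comb P Q R 0 0 1].
Proof. by rewrite /comb !scale1r !scale0r !addr0 !add0r. Qed.

Ltac jac_index x S :=
  tryif constr_eq x S then fail
  else (rewrite (_ : x = S); last by apply/val_inj; rewrite /=; ring).
Ltac jac_nat n N :=
  tryif constr_eq n N then fail else (rewrite (_ : n = N); last by ring).
Ltac jac_close eX Xp Xpp S N :=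
  repeat match goal with
  | |- context [eX ?x ?n] => first [jac_index x S | jac_nat n N]
  | |- context [Xp ?x ?n] => first [jac_index x S | jac_nat n N]
  | |- context [Xpp ?x ?n] => first [jac_index x S | jac_nat n N]
  end;
  let f := fresh "f" in let e1 := fresh "e1" in let e2 := fresh "e2" in
  let e3 := fresh "e3" in let D := fresh "D" in let Z := fresh "Z" in
  let M := fresh "M" in
  have [e1 e2 e3] := combE (eX S N) (Xp S N) (Xpp S N);
  have D := @combD (eX S N) (Xp S N) (Xpp S N);
  have Z := @combZ (eX S N) (Xp S N) (Xpp S N);
  have M := @combN (eX S N) (Xp S N) (Xpp S N);
  set f := comb _ _ _ in e1 e2 e3 D Z M;
  clearbody f; rewrite ?e1 ?e2 ?e3 ?scaleN1r ?(D, Z, M);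
  congr (f _ _ _); rewrite /= ?natrD; field; try by [].

Let jacLLL (a : even_index) i (b : even_index) j (c : even_index) k :
  br (eL a i) (br (eL b j) (eL c k)) =
  br (br (eL a i) (eL b j)) (eL c k) + br (eL b j) (br (eL a i) (eL c k)).
Proof.
jac_expand.
jac_close eL Lp Lpp (addLL (addLL a b) c) (i + j + k)%N.
Qed.

Let jacLLG (a : even_index) i (b : even_index) j (c : odd_index) k :
  br (eL a i) (br (eL b j) (eG c k)) =
  br (br (eL a i) (eL b j)) (eG c k) + br (eL b j) (br (eL a i) (eG c k)).
Proof.
jac_expand.
jac_close eG Gp Gpp (addLG (addLL a b) c) (i + j + k)%N.
Qed.

Let jacLGL (a : even_index) i (b : odd_index) j (c : even_index) k :
  br (eL a i) (br (eG b j) (eL c k)) =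
  br (br (eL a i) (eG b j)) (eL c k) + br (eG b j) (br (eL a i) (eL c k)).
Proof.
jac_expand.
jac_close eG Gp Gpp (addLG (addLL a c) b) (i + j + k)%N.
Qed.

Let jacLGG (a : even_index) i (b : odd_index) j (c : odd_index) k :
  br (eL a i) (br (eG b j) (eG c k)) =
  br (br (eL a i) (eG b j)) (eG c k) + br (eG b j) (br (eL a i) (eG c k)).
Proof.
jac_expand.
jac_close eL Lp Lpp (addLL a (addGG b c)) (i + j + k)%N.
Qed.

Let jacGLL (a : odd_index) i (b : even_index) j (c : even_index) k :
  br (eG a i) (br (eL b j) (eL c k)) =
  br (br (eG a i) (eL b j)) (eL c k) + br (eL b j) (br (eG a i) (eL c k)).
Proof.
jac_expand.
jac_close eG Gp Gpp (addLG (addLL b c) a) (i + j + k)%N.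
Qed.

Let jacGLG (a : odd_index) i (b : even_index) j (c : odd_index) k :
  br (eG a i) (br (eL b j) (eG c k)) =
  br (br (eG a i) (eL b j)) (eG c k) + br (eL b j) (br (eG a i) (eG c k)).
Proof.
jac_expand.
jac_close eL Lp Lpp (addLL b (addGG a c)) (i + j + k)%N.
Qed.

Let jacGGL (a : odd_index) i (b : odd_index) j (c : even_index) k :
  br (eG a i) (br (eG b j) (eL c k)) =
  br (br (eG a i) (eG b j)) (eL c k) - br (eG b j) (br (eG a i) (eL c k)).
Proof.
jac_expand.
jac_close eL Lp Lpp (addLL c (addGG a b)) (i + j + k)%N.
Qed.

Let jacGGG (a : odd_index) i (b : odd_index) j (c : odd_index) k :
  br (eG a i) (br (eG b j) (eG c k)) =
  br (br (eG a i) (eG b j)) (eG c k) - br (eG b j) (br (eG a i) (eG c k)).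
Proof.
jac_expand.
jac_close eG Gp Gpp (addLG (addGG a b) c) (i + j + k)%N.
Qed.

Lemma jacobi_generators k l m :
  let e n := match n : sv_index with inl p => eL p.1 p.2 | inr p => eG p.1 p.2 end in
  br (e k) (br (e l) (e m)) = br (br (e k) (e l)) (e m)
    + (-1) ^+ (sv_parity k && sv_parity l) *: br (e l) (br (e k) (e m)).
Proof.
case: k l m => [[a i]|[a i]] [[b j]|[b j]] [[c k]|[c k]];
  rewrite /sv_parity [_ && _]/= ?expr0 ?expr1 ?scale1r ?scaleN1r /fst /snd.
- exact: jacLLL.
- exact: jacLLG.
- exact: jacLGL.
- exact: jacLGG.
- exact: jacGLL.
- exact: jacGLG.
- exact: jacGGL.
- exact: jacGGG.
Qed.

End JacobiOnGenerators.

Lemma sv_jacobiU k l m :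
  sv_br << k >> (sv_br << l >> << m >>) = sv_br (sv_br << k >> << l >>) << m >>
  + (-1) ^+ (sv_parity k && sv_parity l) *: sv_br << l >> (sv_br << k >> << m >>).
Proof.
have E n : match n with inl p => svL p.1 p.2 | inr p => svG p.1 p.2 end
    = << n >> by case: n => [[? ?]|[? ?]].
rewrite -!E; apply: (@jacobi_generators _ sv_br svL svG) => *; exact: sv_brU.
Qed.

Lemma sv_br_jacobi p q x y z : x \in sv_part p -> y \in sv_part q ->
  sv_br x (sv_br y z) =
    sv_br (sv_br x y) z + (-1) ^+ (p && q) *: sv_br y (sv_br x z).
Proof.
have comb (c e : K) (a1 a2 b1 b2 : sv_space) :
    c *: (a1 + e *: a2) + (b1 + e *: b2) = c *: a1 + b1 + e *: (c *: a2 + b2).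
  by rewrite !scalerDr !scalerA (mulrC c) addrACA.
move=> xp yq.
pattern x; apply: (sv_part_ind xp) => [|c u v up vp|k <-].
- by rewrite !(sv_br0l, sv_br0r) scaler0 addr0.
- by rewrite !(sv_brPl, sv_brPr) up vp comb.
pattern y; apply: (sv_part_ind yq) => [|c u v up vp|l <-].
- by rewrite !(sv_br0l, sv_br0r) scaler0 addr0.
- by rewrite !(sv_brPl, sv_brPr) up vp comb.
pattern z; apply: malg_ind => [|c u v up vp|m _].
- by rewrite !sv_br0r scaler0 addr0.
- by rewrite !sv_brPr up vp comb.
exact: sv_jacobiU.
Qed.

Definition superVirasoro : lieSuperalgebra K :=
  LieSuperalgebra (lsa_br := sv_br) sv_part_submod sv_part_direct sv_part_sum
    sv_br_part sv_br_skew sv_br_jacobi.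

End SuperVirasoro.

(* Main.v *)
Require Import Defs.
From HB Require Import structures.
From mathcomp Require Import all_boot all_order all_algebra.
From mathcomp Require Import monalg ring boolp.
From mathcomp Require Import complex classical_sets reals.

(* The ad-action of d = L_{0,0} is d/dx on the basis x^n e^{wx}, hence onto.  So
   a cocycle psi is corrected by a coboundary to phi with phi(d, -) = 0, and the
   cocycle identity then makes phi invariant under ad d.  On a pair of basis
   vectors of weights v and w this reads
   (v + w) phi(i, j) + i phi(i - 1, j) + j phi(i, j - 1) = 0 for all i, j, which
   forces phi = 0: for v + w <> 0 by induction on i + j, and for v + w = 0 by
   moving i down to 0 at the expense of j. *)

Set Implicit Arguments.
Unset Strict Implicit.
Unset Printing Implicit Defensive.

Import Order.TTheory GRing.Theory Num.Theory.
Local Open Scope classical_set_scope.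
Local Open Scope ring_scope.
Local Open Scope complex_scope.

(** Skew-symmetry and the Jacobi identity of the bracket pass through the linear form. *)
Lemma coboundaries2_sub (K : fieldType) (L : lieSuperalgebra K) :
  coboundaries2 L `<=` cocycles2 L.
Proof.
move=> _ [f ->]; split=> [|a b x y xa yb|a b x y z xa yb].
- split=> [y|x] c u v; first by rewrite linearPl linearP.
  by rewrite linearPr linearP.
- by rewrite (lsa_br_skew xa yb) linearN linearZ.
- by rewrite (lsa_br_jacobi _ xa yb) linearD linearZ.
Qed.

(** * Two recurrences coming from d/dx on x^n e^{wx} *)

Section Recurrences.
Variable K : numFieldType.

(** Values at x^n e^{wx} of a linear form whose composite with d/dx takes the values [h n]. For
    [w = 0] they come from x^n being the derivative of x^(n+1)/(n+1). *)
Fixpoint primitive (w : K) (h : nat -> K) (n : nat) : K :=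
  if w == 0 then h n.+1 / n.+1%:R
  else if n is n'.+1 then (h n - n%:R * primitive w h n') / w else h 0%N / w.

(** The side condition is the case [w = 0], [n = 0], where the left side vanishes because d/dx kills
    constants. *)
Lemma primitiveE w h n : (w = 0 -> h 0%N = 0) ->
  w * primitive w h n + n%:R * primitive w h n.-1 = h n.
Proof.
have [->|w0 _] := eqVneq w 0 => [/(_ erefl) h0|].
  case: n => [|n]; rewrite mul0r add0r ?mul0r ?h0 //=.
  have -> : primitive 0 h n = h n.+1 / n.+1%:R by case: n; rewrite /= eqxx.
  by rewrite mulrC divfK ?pnatr_eq0.
case: n => [|n] /=; rewrite (negPf w0) mulrC divfK //.
  by rewrite mul0r addr0.
by rewrite subrK.
Qed.

Lemma invariant_form_eq0 (w : K) (F : nat -> nat -> K) :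
  (forall i j, w * F i j + i%:R * F i.-1 j + j%:R * F i j.-1 = 0) ->
  forall i j, F i j = 0.
Proof.
move=> FE; have [w0|w0] := eqVneq w 0.
  elim=> [|i IHi] j.
    (* The equation is taken at [j.+1] so that its last term is a nonzero multiple of [F] at [j]. *)
    have := FE 0%N j.+1; rewrite w0 !mul0r !add0r => /eqP.
    by rewrite mulf_eq0 pnatr_eq0 /= => /eqP.
  have := FE i.+1 j.+1; rewrite w0 /= IHi mulr0 mul0r !add0r => /eqP.
  by rewrite mulf_eq0 pnatr_eq0 /= => /eqP.
move=> i j; have [n] := ubnP (i + j); elim: n i j => // n IHn i j ltn.
have Fi : i%:R * F i.-1 j = 0.
  by case: i ltn => [|i] ltn; rewrite ?mul0r // IHn ?mulr0.
have Fj : j%:R * F i j.-1 = 0.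
  by case: j ltn {Fi} => [|j] ltn; rewrite ?mul0r // IHn ?mulr0 // -ltnS -addnS.
have /eqP := FE i j; rewrite Fi Fj !addr0 mulf_eq0 (negPf w0) /=.
by move/eqP.
Qed.

End Recurrences.

(* The case x = y = z = g of the cocycle identity, for an odd g with
   [g, g] = 2 d. *)
Lemma odd_jacobi_eq0 (K : numFieldType) (V : lmodType K) (psi : V -> V -> K)
    (g d : V) :
  bilinear_for *%R *%R psi -> psi g d = - psi d g ->
  psi g (2 *: d) = psi (2 *: d) g - psi g (2 *: d) -> psi d g = 0.
Proof.
move=> [psil psir] gd.
have psiPr c u v : psi g (c *: u + v) = c * psi g u + psi g v by exact: psir.
have psiPl c u v : psi (c *: u + v) g = c * psi u g + psi v g by exact: psil.
have psi0r : psi g 0 = 0.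
  by have := psiPr (-1) 0 0; rewrite scaleN1r addNr mulN1r addNr.
have psi0l : psi 0 g = 0.
  by have := psiPl (-1) 0 0; rewrite scaleN1r addNr mulN1r addNr.
have psiZr : psi g (2 *: d) = 2 * psi g d.
  by rewrite -[2 *: d]addr0 psiPr psi0r addr0.
have psiZl : psi (2 *: d) g = 2 * psi d g.
  by rewrite -[2 *: d]addr0 psiPl psi0l addr0.
rewrite psiZl psiZr gd => e.
have /eqP : 6 * psi d g = 0.
  transitivity (2 * psi d g - 2 * - psi d g - 2 * - psi d g); first by ring.
  by rewrite -e subrr.
by rewrite mulf_eq0 pnatr_eq0 /= => /eqP.
Qed.

(** * The action of L_{0,0} on the basis *)

Section SuperVirasoroCocycles.
Variables (K : numFieldType) (Gamma : zmodClosed K) (s : K).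
Hypothesis s2 : 2 * s \in Gamma.

Let space := sv_space Gamma s.
(** Separating the first index from the second treats L and G uniformly: ad d has the same form on
    both. *)
Let family := (even_index Gamma + odd_index Gamma s)%type.

Let key (c : family) (n : nat) : sv_index Gamma s :=
  match c with inl a => inl (a, n) | inr m => inr (m, n) end.
Let keyE k : exists c n, k = key c n.
Proof.
by case: k => [[a n]|[m n]]; [exists (inl a), n|exists (inr m), n].
Qed.
Let weight (c : family) : K :=
  match c with inl a => val a | inr m => val m end.
Let vec c n : space := << key c n >>.

Let zero_index : even_index Gamma := exist _ 0 (rpred0 Gamma).
Let d : space := svL s zero_index 0.

Let br_d c n :
  sv_br s2 d (vec c n) = weight c *: vec c n + n%:R *: vec c n.-1.
Proof.
(* At [n = 0] the bracket contains the zero vector where the formula has [vec c 0]; both carry the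
   coefficient 0. *)
have zs (V : lmodType K) (u v : V) : 0%:R *: u = 0%:R *: v.
  by rewrite !scale0r.
rewrite /d /vec /svL sv_brU; case: c => [a|m] /=.
  have a0 : addLL zero_index a = a by apply/val_inj; rewrite /= add0r.
  rewrite /svLL /= !subr0 add0n a0.
  by case: n => [|n]; [congr (_ + _); exact: zs|reflexivity].
have m0 : addLG zero_index m = m by apply/val_inj; rewrite /= add0r.
rewrite /svLG /= !mul0r !subr0 add0n m0.
by case: n => [|n]; [congr (_ + _); exact: zs|reflexivity].
Qed.

(** * Correcting a cocycle by a coboundary *)

Variable psi : space -> space -> K.
Hypothesis psi_cocycle : cocycles2 (superVirasoro s2) psi.

Let psiPl y c u v : psi (c *: u + v) y = c * psi u y + psi v y.
Proof. by case: psi_cocycle => [[H _] _ _]; exact: H. Qed.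
Let psiPr x c u v : psi x (c *: u + v) = c * psi x u + psi x v.
Proof. by case: psi_cocycle => [[_ H] _ _]; exact: H. Qed.

(** This is the side condition of [primitiveE]. An even vector of weight 0 is d itself, and
    skew-symmetry applies; an odd one has square 2 d, and [odd_jacobi_eq0] applies. *)
Let psi_d_kernel c : weight c = 0 -> psi d (vec c 0) = 0.
Proof.
case: psi_cocycle => _ skew jac.
case: c => [a|m] /= w0.
  have -> : vec (inl a) 0 = d.
    by rewrite /vec /d /svL; congr << inl (_, _) >>; apply/val_inj.
  have dd := @skew false false d d (sv_partU _) (sv_partU _).
  move: dd; rewrite mul1r => /eqP; rewrite -subr_eq0 opprK -mulr2n mulrn_eq0 /=.
  by move/eqP.
set g := vec _ _.
have gg : sv_br s2 g g = 2 *: d.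
  rewrite /g /vec sv_brU /= /svGG; congr (_ *: << inl (_, _) >>).
  by apply/val_inj; rewrite /= w0 addr0.
apply: (@odd_jacobi_eq0 _ _ psi g d).
- by split=> [y|x] c u v; [exact: psiPl|exact: psiPr].
- transitivity (- ((-1) ^+ false * psi d g)); last by rewrite expr0 mul1r.
  exact: (@skew true false g d (sv_partU _) (sv_partU _)).
- rewrite -gg -mulN1r.
  exact: (@jac true true g g g (sv_partU _) (sv_partU _)).
Qed.

(** The codomain is [K^o], the field as a module over itself, so that [malg_lift] applies. *)
Let f_index (k : sv_index Gamma s) : K^o :=
  match k with
  | inl (a, n) => primitive (weight (inl a)) (fun i => psi d (vec (inl a) i)) n
  | inr (m, n) => primitive (weight (inr m)) (fun i => psi d (vec (inr m) i)) n
  end.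
Let f : space -> K := malg_lift f_index.
Let f_linear c u v : f (c *: u + v) = c * f u + f v.
Proof. exact: (malg_lift_linear f_index). Qed.

Let fD u v : f (u + v) = f u + f v.
Proof. by rewrite -[u in LHS]scale1r f_linear mul1r. Qed.

Let f_br_d k : f (sv_br s2 d << k >>) = psi d << k >>.
Proof.
have [c [n ->]] := keyE k.
have fvec i : f (vec c i) = primitive (weight c) (fun i => psi d (vec c i)) i.
  by rewrite /f [LHS]malg_liftU; case: (c).
have f0 : f 0 = 0.
  by have := f_linear (-1) 0 0; rewrite scaleN1r addNr mulN1r addNr.
rewrite -/(vec c n) br_d f_linear -[_ *: vec c n.-1]addr0 f_linear f0 addr0 !fvec.
by rewrite -[RHS](@primitiveE _ (weight c) (fun i => psi d (vec c i))) //
  => /psi_d_kernel.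
Qed.

(** * Vanishing of the corrected cocycle *)

Let phi x y := psi x y - f (sv_br s2 x y).

Let linear_combB (c p q p' q' : K) :
  c * (p - q) + (p' - q') = c * p + p' - (c * q + q').
Proof. by ring. Qed.

Let phiPl y c u v : phi (c *: u + v) y = c * phi u y + phi v y.
Proof.
by rewrite /phi (psiPl y c u v) (sv_brPl s2 y c u v) f_linear [RHS]linear_combB.
Qed.

Let phiPr x c u v : phi x (c *: u + v) = c * phi x u + phi x v.
Proof.
by rewrite /phi (psiPr x c u v) (sv_brPr s2 x c u v) f_linear [RHS]linear_combB.
Qed.


Let phi0l y : phi 0 y = 0.
Proof. by have := phiPl y (-1) 0 0; rewrite scaleN1r addNr mulN1r addNr. Qed.
Let phi0r x : phi x 0 = 0.
Proof. by have := phiPr x (-1) 0 0; rewrite scaleN1r addNr mulN1r addNr. Qed.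

Let phi_d x : phi d x = 0.
Proof.
pattern x; apply: malg_ind => [|c u v u0 v0|k _]; first exact: phi0r.
  by rewrite (phiPr _ c u v) u0 v0 mulr0 addr0.
by rewrite /phi f_br_d subrr.
Qed.

(** Subtracting the image under [f] of the Jacobi identity for d, [<< k >>], [y] from the cocycle
    identity of [psi] leaves this sum equal to a value of [phi d]. No sign appears since d is
    even. *)
Let phi_invariant k y :
  phi (sv_br s2 d << k >>) y + phi << k >> (sv_br s2 d y) = 0.
Proof.
have [_ _ jac] := psi_cocycle.
rewrite -(phi_d (sv_br s2 << k >> y)) /phi.
rewrite (sv_br_jacobi _ _ (sv_partU (inl _)) (sv_partU k)).
have -> : psi d (sv_br s2 << k >> y) =
    psi (sv_br s2 d << k >>) y + (-1) ^+ false * psi << k >> (sv_br s2 d y).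
  exact: (@jac false (sv_parity k) d << k >> y (sv_partU _) (sv_partU _)).
by rewrite expr0 scale1r mul1r fD opprD addrACA.
Qed.

Let phi_vec c e i j : phi (vec c i) (vec e j) = 0.
Proof.
apply: (@invariant_form_eq0 _ (weight c + weight e)
  (fun i j => phi (vec c i) (vec e j))) => {}i {}j.
have := phi_invariant (key c i) (vec e j); rewrite -/(vec c i) !br_d.
have phiDl x u v z w : phi (z *: u + w *: v) x = z * phi u x + w * phi v x.
  rewrite phiPl; congr (_ + _).
  by rewrite -[w *: v]addr0 phiPl (phi0l x) [LHS]addr0.
have phiDr x u v z w : phi x (z *: u + w *: v) = z * phi x u + w * phi x v.
  rewrite phiPr; congr (_ + _).
  by rewrite -[w *: v]addr0 phiPr (phi0r x) [LHS]addr0.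
(* Expanding both brackets gives four terms; the two multiples of [phi (vec c i) (vec e j)] merge,
   so the weights add. *)
rewrite (phiDl _ (vec c i) (vec c i.-1)) (phiDr _ (vec e j) (vec e j.-1)).
move: (phi _ _) (phi (vec c i.-1) _) (phi _ (vec e j.-1)) => p q r <-; ring.
Qed.

Lemma cocycle_coboundary : coboundaries2 (superVirasoro s2) psi.
Proof.
have phi0 x y : phi x y = 0.
  pattern x; apply: malg_ind => [|c u v u0 v0|k _]; first exact: phi0l.
    by rewrite (phiPl _ c u v) u0 v0 mulr0 addr0.
  pattern y; apply: malg_ind => [|c u v u0 v0|l _]; first exact: phi0r.
    by rewrite (phiPr _ c u v) u0 v0 mulr0 addr0.
  have [c [i ->]] := keyE k; have [e [j ->]] := keyE l.
  exact: phi_vec.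
(* Now [psi] agrees with the coboundary of [f], which only has to be bundled as a linear form. *)
pose f_lin := GRing.isLinear.Build K space K *%R f f_linear.
pose F : {scalar space} := HB.pack f f_lin.
exists F; apply/funext => x; apply/funext => y.
by apply/eqP; rewrite -subr_eq0; apply/eqP/phi0.
Qed.

End SuperVirasoroCocycles.

Theorem theorem5p3 (R : realType) (Gamma : zmodClosed R[i]) (s : R[i])
    (GammaZ : forall n : int, n%:~R \in Gamma) (s2 : 2 * s \in Gamma) :
  cocycles2 (superVirasoro s2) = coboundaries2 (superVirasoro s2).
Proof.
apply/seteqP; split; last exact: coboundaries2_sub.
by move=> psi; apply: cocycle_coboundary.
Qed.
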